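(* There exists a continuous viscosity solution $u$ to the Dirichlet problem $$F(w,u,u',u'')=0\ \text{ in }(b,w_s),\qquad u(b)=1,\quad u(w_s)=0,$$ that takes values in $[0,1]$. More precisely, it is bounded from below by $\psi_0$ and from above by $\mathfrak p$.
   Context: Constants: $r>0$, $\mu>r$, $\sigma>0$, $c>0$, $\lambda>0$, $\varepsilon>0$, $b\in\mathbb{R}$ with $b<w_s:=c/r$; $R=\frac12\left(\frac{\mu-r}{\sigma}\right)^2$ and $d=\frac1{2r}\left[(r+\lambda+R)+\sqrt{(r+\lambda+R)^2-4r\lambda}\right]>1$. $F$ is the $(-\infty,+\infty]$-valued function $$F(w,u,p,A)=\lambda u-\inf_{\pi\in\mathbb R}\left\{\frac12\sigma^2(\varepsilon p^2+A)\pi^2+(\mu-r)p\,\pi+(rw-c)p\right\}.$$ An upper semicontinuous (u.s.c.) function $u$ is a viscosity subsolution of $F=0$ in $(b,w_s)$ if $F(w_0,u(w_0),\varphi'(w_0),\varphi''(w_0))\le0$ whenever $\varphi\in C^2(b,w_s)$ and $u-\varphi$ has a local maximum at $w_0\in(b,w_s)$. A lower semicontinuous (l.s.c.) function $u$ is a viscosity supersolution if $F(w_0,u(w_0),\varphi'(w_0),\varphi''(w_0))\ge0$ whenever $\varphi\in C^2(b,w_s)$ and $u-\varphi$ has a local minimum at $w_0\in(b,w_s)$ (the inequality holds trivially if $F=+\infty$). A viscosity solution is a function whose u.s.c. envelope is a subsolution and whose l.s.c. envelope is a supersolution. For $w\in[b,w_s]$: $$\psi_0(w)=\left(\frac{c-rw}{c-rb}\right)^d,\qquad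 \mathfrak p(w)=\frac1\varepsilon\ln\left[1+(e^\varepsilon-1)\left(\frac{c-rw}{c-rb}\right)^{\frac Rr+1}\right].$$ *)

(* Defs.v *)
From mathcomp Require Import all_boot all_order all_algebra.
From mathcomp Require Import all_classical all_reals all_analysis.

Set Implicit Arguments.
Unset Strict Implicit.
Unset Printing Implicit Defensive.

Import Order.TTheory GRing.Theory Num.Theory.
Import numFieldNormedType.Exports.

Local Open Scope ring_scope.
Local Open Scope classical_set_scope.

(* Functions on a set D (an open interval in the application) are total       *)
(* functions R -> R whose values outside D are irrelevant: hence the filters  *)
(* [within D (nbhs x)] below.                                                 *)

Definition usc_on (R : realType) (D : set R) (u : R -> R) : Prop :=
  forall x, D x -> forall y, u x < y ->
    \forall z \near within D (nbhs x), u z < y.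

Definition lsc_on (R : realType) (D : set R) (u : R -> R) : Prop :=
  forall x, D x -> forall y, y < u x ->
    \forall z \near within D (nbhs x), y < u z.

(* Since x itself belongs to every neighborhood in [nbhs x], these limsup and *)
(* liminf are the semicontinuous envelopes of u at x.                         *)
Definition usc_env (R : realType) (D : set R) (u : R -> R) (x : R) : \bar R :=
  limf_esup (EFin \o u) (within D (nbhs x)).

Definition lsc_env (R : realType) (D : set R) (u : R -> R) (x : R) : \bar R :=
  limf_einf (EFin \o u) (within D (nbhs x)).

Definition C2_on (R : realType) (D : set R) (phi : R -> R) : Prop :=
  forall x, D x ->
    [/\ derivable phi x 1, derivable phi^`() x 1
      & {for x, continuous phi^`(2)}].

Definition local_max_on (R : realType) (D : set R) (f : R -> R) (x : R) : Prop :=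
  \forall z \near within D (nbhs x), f z <= f x.

Definition local_min_on (R : realType) (D : set R) (f : R -> R) (x : R) : Prop :=
  \forall z \near within D (nbhs x), f x <= f z.

Definition viscosity_subsolution (R : realType)
    (F : R -> R -> R -> R -> \bar R) (D : set R) (u : R -> R) : Prop :=
  usc_on D u /\
  forall (phi : R -> R) (w0 : R), C2_on D phi -> D w0 ->
    local_max_on D (fun w => u w - phi w) w0 ->
    (F w0 (u w0) (phi^`() w0) (phi^`(2) w0) <= 0)%E.

Definition viscosity_supersolution (R : realType)
    (F : R -> R -> R -> R -> \bar R) (D : set R) (u : R -> R) : Prop :=
  lsc_on D u /\
  forall (phi : R -> R) (w0 : R), C2_on D phi -> D w0 ->
    local_min_on D (fun w => u w - phi w) w0 ->
    (0 <= F w0 (u w0) (phi^`() w0) (phi^`(2) w0))%E.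

(* Sub- and supersolutions are real-valued, so the envelopes are required to  *)
(* be finite on D (equivalently, u is locally bounded in D); [fine] then      *)
(* loses no information.                                                      *)
Definition viscosity_solution (R : realType)
    (F : R -> R -> R -> R -> \bar R) (D : set R) (u : R -> R) : Prop :=
  [/\ forall x, D x ->
        usc_env D u x \is a fin_num /\ lsc_env D u x \is a fin_num,
      viscosity_subsolution F D (fun x => fine (usc_env D u x))
    & viscosity_supersolution F D (fun x => fine (lsc_env D u x))].

Section Problem.
Variables (R : realType) (r mu sigma c lambda eps b : R).

(* The infimum ranges over an unbounded set and may be -oo, in which case the *)
(* value is +oo; the value is never -oo.                                      *)
Definition hjbF (w u p A : R) : \bar R :=
  ((lambda * u)%:E -
   ereal_inf (range (fun pi : R =>
     (2^-1 * sigma ^+ 2 * (eps * p ^+ 2 + A) * pi ^+ 2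
      + (mu - r) * p * pi + (r * w - c) * p)%:E)))%E.

Definition safe_level : R := c / r.

(* The constant written R in the mathematical text.                           *)
Definition Rconst : R := 2^-1 * ((mu - r) / sigma) ^+ 2.

Definition dconst : R :=
  (2 * r)^-1 * ((r + lambda + Rconst)
    + Num.sqrt ((r + lambda + Rconst) ^+ 2 - 4 * r * lambda)).

Definition psi0 (w : R) : R := ((c - r * w) / (c - r * b)) `^ dconst.

Definition pfrak (w : R) : R :=
  eps^-1 * ln (1 + (expR eps - 1) *
                   ((c - r * w) / (c - r * b)) `^ (Rconst / r + 1)).

End Problem.

(* Main.v *)
Require Import Defs.
From mathcomp Require Import all_boot all_order all_algebra.
From mathcomp Require Import all_classical all_reals all_analysis.
From mathcomp Require Import ring lra.
Import Order.TTheory GRing.Theory Num.Theory.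
Import numFieldNormedType.Exports.
Local Open Scope classical_set_scope.
Local Open Scope ring_scope.

(* The problem has a classical C^2 solution. With x = - ln ((c - r w) / (c - r b))
   the equation becomes autonomous, and looking for u = e^t with
   t' = - h(t) turns it into the first order equation
     h' = 1 - h + Q h / (r h - lambda) - eps e^t h,   t <= 0,
   where Q is the constant R of the text. Its solution that stays bounded as
   t -> - oo is a fixed point of the monotone map sending h to the bounded solution
   of k' + M k = M h + (right-hand side at h) with M large; constants slightly
   above lambda / r and the constant d are a sub- and a supersolution, so that
   Knaster-Tarski applies to the uniformly Lipschitz functions between them. Then
   h <= d is the bound u >= psi0, and 1 + Q h / (r h - lambda) >= 1 + Q / r yields
   u <= pfrak. *)

Set Implicit Arguments.
Unset Strict Implicit.

(** * Differentiation rules in pointwise form, mean value theorem and primitives *)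

Section Calculus.
Context {R : realType}.
Implicit Types (f g df : R -> R) (x y l a b : R).

Lemma is_derive_addf f g x a b : is_derive x 1 f a -> is_derive x 1 g b ->
  is_derive x 1 (fun y => f y + g y) (a + b).
Proof. by move=> fa gb; exact: is_deriveD. Qed.

Lemma is_derive_cstf x a : is_derive x 1 (fun=> a) 0.
Proof. exact: (is_derive_cst a x 1). Qed.

Lemma is_derive_idf x : is_derive x 1 (fun y => y) 1.
Proof. exact: is_derive_id. Qed.

Lemma is_derive_mulf f g x a b : is_derive x 1 f a -> is_derive x 1 g b ->
  is_derive x 1 (fun y => f y * g y) (a * g x + f x * b).
Proof.
move=> fa gb; apply: (is_derive_eq (is_deriveM fa gb)).
by rewrite /GRing.scale /= addrC (mulrC (g x)).
Qed.

Lemma is_derive_cmulf l f x a : is_derive x 1 f a ->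
  is_derive x 1 (fun y => l * f y) (l * a).
Proof. by move=> fa; exact: (is_deriveZ l fa). Qed.

Lemma is_derive_oppf f x a : is_derive x 1 f a ->
  is_derive x 1 (fun y => - f y) (- a).
Proof. by move=> fa; exact: is_deriveN. Qed.

Lemma is_derive_subf f g x a b : is_derive x 1 f a -> is_derive x 1 g b ->
  is_derive x 1 (fun y => f y - g y) (a - b).
Proof. by move=> fa gb; exact: is_deriveB. Qed.

Lemma is_derive_compf f g x a b : is_derive x 1 g b -> is_derive (g x) 1 f a ->
  is_derive x 1 (fun y => f (g y)) (a * b).
Proof. by move=> gb fa; exact: is_derive1_comp. Qed.

Lemma is_derive_expf f x a : is_derive x 1 f a ->
  is_derive x 1 (fun y => expR (f y)) (expR (f x) * a).
Proof. by move=> fa; exact: (is_derive_compf fa (is_derive_expR _)). Qed.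

Lemma is_derive_invf f x a : f x != 0 -> is_derive x 1 f a ->
  is_derive x 1 (fun y => (f y)^-1) (- (f x) ^- 2 * a).
Proof. by move=> fx fa; exact: is_deriveV. Qed.

Lemma is_derive_cont f x l : is_derive x 1 f l -> {for x, continuous f}.
Proof.
by move=> [fd _]; apply: differentiable_continuous; exact/derivable1_diffP.
Qed.

Lemma is_derive_mvt f df a b : a <= b ->
  (forall x, a <= x <= b -> is_derive x 1 f (df x)) ->
  exists2 c, a <= c <= b & f b - f a = df c * (b - a).
Proof.
move=> ab fdf; have [||c cab fE] := @MVT_segment R f df a b ab.
- by move=> x /[!in_itv]/= /andP[ax xb]; apply: fdf; rewrite !ltW.
- apply: continuous_in_subspaceT => x /[!inE]/= /[!in_itv]/= xab.
  exact: is_derive_cont (fdf _ xab).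
- by exists c; move: cab; rewrite // in_itv.
Qed.

Lemma is_derive_ge0_le f df a b : a <= b ->
  (forall x, a <= x <= b -> is_derive x 1 f (df x)) ->
  (forall x, a <= x <= b -> 0 <= df x) -> f a <= f b.
Proof.
move=> ab fdf df0; have [c cab fE] := is_derive_mvt ab fdf.
by rewrite -subr_ge0 fE mulr_ge0 ?subr_ge0 ?df0.
Qed.

Lemma is_derive_near f g x l : (\forall z \near x, f z = g z) ->
  is_derive x 1 f l -> is_derive x 1 g l.
Proof. by move=> fg fl; apply: near_eq_is_derive fl. Qed.

Lemma primitive_right g a : continuous g ->
  exists G : R -> R, forall x, a < x -> is_derive x 1 G (g x).
Proof.
move=> cg; exists (fun y => \int[lebesgue_measure]_(t in `[a, y]) g t)%R => x ax.
have [||D1 D2] := @continuous_FTC1_closed R g a x (x + 1) _ _ ax (cg x).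
- by rewrite ltrDl.
- apply: continuous_compact_integrable; first exact: segment_compact.
  exact: continuous_subspaceT.
by rewrite -D2 derive1E; exact: derivableP.
Qed.

(** [primitive_right] differentiates only to the right of its base point. Based at [-1] it covers
    [x > -1]; applied to [fun x => g (- x)] and reflected, it covers [x < 1]. On the overlap the two
    agree, their difference having derivative [0] and vanishing at [0], so they can be glued at
    [0]. *)
Lemma primitive g : continuous g ->
  exists G : R -> R, G 0 = 0 /\ forall x, is_derive x 1 G (g x).
Proof.
move=> cg; have [F FE] := primitive_right (-1) cg.
have [|H HE] := @primitive_right (fun x => g (- x)) (-1).
  by move=> x; apply: continuous_comp; [exact: opp_continuous|exact: cg].
pose F1 x := F x - F 0; pose F2 x := H 0 - H (- x).
have F1E x : -1 < x -> is_derive x 1 F1 (g x).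
  move=> x1; rewrite -[g x]subr0.
  exact: (is_derive_subf (FE x x1) (is_derive_cstf x (F 0))).
have F2E x : x < 1 -> is_derive x 1 F2 (g x).
  move=> x1; have x1N : -1 < - x by rewrite ltrN2.
  have := is_derive_compf (is_deriveNid x 1) (HE _ x1N).
  move/(is_derive_subf (is_derive_cstf x (H 0))).
  by rewrite mulrN1 sub0r !opprK.
have F12 x : -1 < x < 1 -> F1 x = F2 x.
  move=> /andP[x1 x2].
  have D (z : R) : -1 < z < 1 -> is_derive z 1 (fun y => F1 y - F2 y) 0.
    move=> /andP[z1 z2]; rewrite -(subrr (g z)).
    by apply: is_derive_subf; [exact: F1E|exact: F2E].
  apply/eqP; rewrite -subr_eq0; apply/eqP.
  have E0 : F1 0 - F2 0 = 0 by rewrite /F1 /F2 oppr0 !subrr.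
  have [x0|x0] := leP 0 x.
    have [|c _] := @is_derive_mvt (fun y => F1 y - F2 y) (fun=> 0) 0 x x0.
      by move=> z ?; apply: D; lra.
    by rewrite E0 mul0r subr0.
  have [|c _] := @is_derive_mvt (fun y => F1 y - F2 y) (fun=> 0) x 0 (ltW x0).
    by move=> z ?; apply: D; lra.
  by rewrite E0 mul0r => /eqP; rewrite sub0r oppr_eq0 => /eqP.
exists (fun x => if x < 0 then F2 x else F1 x); split.
  by rewrite ltxx /F1 subrr.
move=> x; have [x0|x0] := leP 0 x.
  apply: (@is_derive_near F1); last by apply: F1E; lra.
  near=> z; case: ifPn => // z0; apply: F12.
  rewrite (lt_trans z0 ltr01) andbT.
  by near: z; apply: lt_nbhsr; lra.
apply: (@is_derive_near F2); last by apply: F2E; lra.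
near=> z; rewrite ifT//; near: z; exact: lt_nbhsl.
Unshelve. all: by end_near. Qed.

End Calculus.

(** * Bounded solutions of first-order equations near minus infinity and on the line *)

Section BoundedSolutions.
Context {R : realType}.
Implicit Types (f g h k : R -> R) (t s M B lo hi : R).

(** Since [expR (M * t) * k t] is nondecreasing, a negative value of [k] would force [k] down
    exponentially as [t] decreases, against the lower bound [B]. *)
Lemma bounded_below_ge0 k dk M B T : 0 < M ->
  (forall t, t <= T -> is_derive t 1 k (dk t)) ->
  (forall t, t <= T -> 0 <= dk t + M * k t) ->
  (forall t, t <= T -> B <= k t) -> forall t, t <= T -> 0 <= k t.
Proof.
move=> M0 kdk dk0 Bk t tT; rewrite leNgt; apply/negP => kt0.
pose E s := expR (M * s) * k s.
have EE s : s <= T -> is_derive s 1 E (expR (M * s) * (dk s + M * k s)).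
  move=> sT; apply: (is_derive_eq (is_derive_mulf (is_derive_expf
    (is_derive_cmulf M (is_derive_idf s))) (kdk _ sT))); ring.
(* Chosen so that [M * (t - s) = |B| / - k t]; then [1 + x <= e^x] gives [k s <= k t - |B| < B]. *)
pose s := t - `|B| / (M * - k t).
have Mk0 : 0 < M * - k t by rewrite mulr_gt0 ?oppr_gt0.
have st : s <= t by rewrite lerBlDr lerDl divr_ge0// ltW.
have : E s <= E t.
  apply: (is_derive_ge0_le st) => r /andP[_ rt].
    exact: EE (le_trans rt tT).
  by rewrite mulr_ge0 ?expR_ge0// dk0// (le_trans rt).
rewrite /E -ler_pdivlMl ?expR_gt0// mulrA -expRN -expRD => ks.
have := Bk _ (le_trans st tT); have := ler_norm (- B); rewrite normrN => NB.
have := expR_ge1Dx (- (M * s) + M * t).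
have -> : - (M * s) + M * t = `|B| / - k t.
  by rewrite /s; field; rewrite ?oppr_eq0 lt_eqF// gt_eqF.
move: ks; have -> : - (M * s) + M * t = `|B| / - k t.
  by rewrite /s; field; rewrite ?oppr_eq0 lt_eqF// gt_eqF.
set X := expR _ => ks X1 Bs.
have : X * k t <= (1 + `|B| / - k t) * k t by rewrite ler_wnM2r// ltW.
have -> : (1 + `|B| / - k t) * k t = k t - `|B|.
  by field; rewrite lt_eqF.
lra.
Qed.

(* [k t = e^{-M t} Q (e^{M t / 2})] with [Q' = g]; the power [M t / 2] makes [g]
   continuous at [0], although [f] need not converge at [-oo]. *)
Lemma bounded_linear_ode f M B : 0 < M -> continuous f ->
  (forall t, `|f t| <= B) ->
  exists k : R -> R, (forall t, is_derive t 1 k (f t - M * k t)) /\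
    forall t, `|k t| <= B / M.
Proof.
move=> M0 cf fB.
pose g (z : R) := if 0 < z then z * (2 / M * f (2 / M * ln z)) else 0.
(* This linear bound gives continuity of [g] at [0]. Integrated, it gives [|Q z| <= B / M * z ^+ 2]
   for [z >= 0], which at [z = e^{M t / 2}] is the bound on [k]. *)
have gB z : `|g z| <= 2 * B / M * `|z|.
  have B0 : 0 <= B by rewrite (le_trans _ (fB 0)).
  rewrite /g; case: ifPn => _; last first.
    by rewrite normr0 mulr_ge0// divr_ge0 ?mulr_ge0// ltW.
  have M2 : 0 < 2 / M by rewrite divr_gt0.
  rewrite normrM mulrC ler_wpM2r// normrM (gtr0_norm M2) (mulrAC 2 B).
  by rewrite ler_pM2l.
have g_pos (z : R) : 0 < z -> {for z, continuous g}.
  move=> z0; have cl : {for z, continuous (fun y : R => 2 / M * ln y)}.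
    apply: cvgM; first exact: cvg_cst.
    exact: continuous_ln.
  have : {for z, continuous (fun y : R => y * (2 / M * f (2 / M * ln y)))}.
    apply: cvgM; first exact: cvg_id.
    apply: cvgM; first exact: cvg_cst.
    by apply: (continuous_comp cl); exact: cf.
  have gz : g z = z * (2 / M * f (2 / M * ln z)) by rewrite /g z0.
  rewrite /prop_for /continuous_at gz; apply: cvg_trans; apply: near_eq_cvg.
  by near=> y; rewrite /g ifT//; near: y; exact: lt_nbhsr.
have g_neg z : z <= 0 -> g z = 0 by move=> z0; rewrite /g ltNge z0.
have cg : continuous g.
  move=> z; have [z0|z0|<-] := ltgtP 0 z; first exact: g_pos.
    rewrite /continuous_at (g_neg z (ltW z0)).
    apply: cvg_near_cst.
    by near=> y; rewrite g_neg// ltW//; near: y; exact: lt_nbhsl.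
  rewrite /continuous_at (g_neg 0 (lexx 0)); apply/cvgr0Pnorm_lt => e e0.
  near=> y; apply: le_lt_trans (gB y) _.
  have BM : 0 < 2 * `|B| / M + 1 by rewrite ltr_wpDl// divr_ge0 ?mulr_ge0// ltW.
  apply: (@le_lt_trans _ _ ((2 * `|B| / M + 1) * `|y|)).
    rewrite ler_wpM2r// ler_wpDr// ler_pM2r ?invr_gt0// ler_pM2l// ler_norm//.
  rewrite -ltr_pdivlMl//; near: y.
  apply: cvgr0_norm_lt; first exact: cvg_id.
  by rewrite mulr_gt0 ?invr_gt0// ltr_wpDl// divr_ge0 ?mulr_ge0// ltW.
have [Q [Q0 QE]] := primitive cg.
have sqE (z : R) : is_derive z 1 (fun y => B / M * y ^+ 2) (2 * B / M * z).
  have := is_derive_cmulf (B / M) (is_derive_mulf (is_derive_idf z) (is_derive_idf z)).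
  by move=> /is_derive_eq; apply; ring.
have QB z : 0 <= z -> `|Q z| <= B / M * z ^+ 2.
  move=> z0; rewrite ler_norml; apply/andP; split.
    have := @is_derive_ge0_le _ _ _ _ _ z0
      (fun y _ => is_derive_addf (QE y) (sqE y)).
    rewrite Q0 expr0n mulr0 addr0 => H.
    rewrite -subr_ge0 opprK; apply: H => y /andP[y0 _].
    by have := gB y; rewrite ler_norml (ger0_norm y0) => /andP[]; lra.
  have := @is_derive_ge0_le _ _ _ _ _ z0
    (fun y _ => is_derive_subf (sqE y) (QE y)).
  rewrite Q0 expr0n mulr0 subr0 => H.
  rewrite -subr_ge0; apply: H => y /andP[y0 _].
  by have := gB y; rewrite ler_norml (ger0_norm y0) => /andP[]; lra.
exists (fun t => expR (- M * t) * Q (expR (M / 2 * t))); split=> t.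
  have eE c := is_derive_expf (is_derive_cmulf c (is_derive_idf t)).
  apply: (is_derive_eq (is_derive_mulf (eE (- M))
    (is_derive_compf (eE (M / 2)) (QE (expR (M / 2 * t)))))).
  rewrite /g expR_gt0 expRK.
  have -> : 2 / M * (M / 2 * t) = t by field; rewrite gt_eqF.
  have -> : expR (- M * t) = (expR (M / 2 * t) * expR (M / 2 * t))^-1.
    by rewrite -expRD -expRN; congr expR; field.
  by field; rewrite gt_eqF ?expR_gt0// gt_eqF.
rewrite normrM gtr0_norm ?expR_gt0//.
rewrite mulNr expRN ler_pdivrMl ?expR_gt0//.
apply: le_trans (QB _ (expR_ge0 _)) _.
rewrite expr2 -expRD; have -> : M / 2 * t + M / 2 * t = M * t by field.
by rewrite mulrC.
Unshelve. all: by end_near. Qed.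

(** Boundedness replaces an initial condition: [k2 - k1] is bounded and solves the linear equation
    with nonnegative source [f2 - f1], so [bounded_below_ge0] applies. *)
Lemma bounded_linear_ode_le f1 f2 k1 k2 M B : 0 < M ->
  (forall t, is_derive t 1 k1 (f1 t - M * k1 t)) ->
  (forall t, is_derive t 1 k2 (f2 t - M * k2 t)) ->
  (forall t, `|k1 t| <= B) -> (forall t, `|k2 t| <= B) ->
  (forall t, f1 t <= f2 t) -> forall t, k1 t <= k2 t.
Proof.
move=> M0 k1E k2E k1B k2B f12 t; rewrite -subr_ge0.
apply: (@bounded_below_ge0 (fun s => k2 s - k1 s) _ M (- (B + B)) t M0
  (fun s _ => is_derive_subf (k2E s) (k1E s))) => // s _.
  by have := f12 s; lra.
by have := k1B s; have := k2B s; rewrite !ler_norml => /andP[? ?] /andP[? ?]; lra.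
Qed.

Lemma lipschitz_cont h K : (forall s t, h t <= h s + K * `|t - s|) ->
  continuous h.
Proof.
move=> hK t; apply/cvgrPdist_lt => e e0.
have K0 : 0 < `|K| + 1 by rewrite ltr_wpDl.
near=> s; apply: (@le_lt_trans _ _ ((`|K| + 1) * `|t - s|)).
  have HK : K * `|t - s| <= (`|K| + 1) * `|t - s|.
    by rewrite ler_wpM2r// ler_wpDr// ler_norm.
  have := hK s t; have := hK t s; rewrite (distrC s t) ler_norml => H1 H2.
  by apply/andP; split; lra.
rewrite -ltr_pdivlMl//; near: s.
by apply: cvgr_dist_lt; [exact: cvg_id|rewrite mulr_gt0 ?invr_gt0].
Unshelve. all: by end_near. Qed.

(** The map sending [h] to the bounded solution of [k' + M k = Phi t (h t)] is monotone by
    comparison, and it preserves [[lo, hi]] because the two constants are a sub- and a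
    supersolution. A fixed point of it solves the equation. *)
Lemma bounded_ode (Phi : R -> R -> R) M lo hi : 0 < M -> lo <= hi ->
  (forall h, continuous h -> (forall t, lo <= h t <= hi) ->
    continuous (fun t => Phi t (h t))) ->
  (forall t x y, lo <= x -> x <= y -> y <= hi -> Phi t x <= Phi t y) ->
  (forall t, M * lo <= Phi t lo) -> (forall t, Phi t hi <= M * hi) ->
  exists h : R -> R, forall t, lo <= h t <= hi /\
    is_derive t 1 h (Phi t (h t) - M * h t).
Proof.
move=> M0 lohi cPhi mPhi Phi_lo Phi_hi.
(* Both [Phi t (h t)] and [M * k t] lie in [[M lo, M hi]], so [K] bounds [k']. A common Lipschitz
   constant survives suprema, which keeps [H] below continuous. *)
pose K := M * (hi - lo).
pose L h := (forall t, lo <= h t <= hi) /\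
  forall s t, h t <= h s + K * `|t - s|.
pose S h k := L k /\ forall t, is_derive t 1 k (Phi t (h t) - M * k t).
pose B := `|lo| + `|hi|.
have normB x : lo <= x <= hi -> `|x| <= B.
  move=> /andP[lx xh]; rewrite /B ler_norml.
  have := ler_norm hi; have := ler_norm (- lo); rewrite normrN.
  have := normr_ge0 hi; have := normr_ge0 lo.
  by move=> *; apply/andP; split; lra.
have PhiB h t : L h -> M * lo <= Phi t (h t) <= M * hi.
  move=> [hB _]; have /andP[h1 h2] := hB t.
  by rewrite (le_trans (Phi_lo t)) ?mPhi//= (le_trans _ (Phi_hi t)) ?mPhi.
have exS h : L h -> exists k, S h k.
  move=> Lh; have [hB hK] := Lh.
  have ch := cPhi _ (lipschitz_cont hK) hB.
  have [|k [kE kB]] := bounded_linear_ode M0 ch (B := M * B).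
    move=> t; have /andP[p1 p2] := PhiB h t Lh.
    have := @normB (M^-1 * Phi t (h t)).
    rewrite ler_pdivlMl// ler_pdivrMl// p1 p2 => /(_ isT).
    by rewrite normrM gtr0_norm ?invr_gt0// ler_pdivrMl.
  have {}kB t : `|k t| <= B by have := kB t; rewrite mulrAC divff ?gt_eqF// mul1r.
  (* The constant [c] is the bounded solution with source [M * c]; comparing [k] with it for
     [c = lo] and [c = hi] traps [k]. *)
  have cstE c t : is_derive t 1 (fun=> c : R) (M * c - M * c).
    by rewrite subrr; exact: is_derive_cstf.
  have kbd t : lo <= k t <= hi.
    apply/andP; split.
      apply: (bounded_linear_ode_le M0 (cstE lo) kE _ kB) => s.
        by apply: normB; rewrite lexx lohi.
      by have /andP[] := PhiB h s Lh.
    apply: (bounded_linear_ode_le M0 kE (cstE hi) kB _) => s.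
      by apply: normB; rewrite lexx lohi.
    by have /andP[] := PhiB h s Lh.
  exists k; split=> //; split=> // s t.
  have dkK r : `|Phi r (h r) - M * k r| <= K.
    have /andP[p1 p2] := PhiB h r Lh; have /andP[k1 k2] := kbd r.
    rewrite -(ler_pM2l M0) in k1; rewrite -(ler_pM2l M0) in k2.
    by rewrite ler_norml /K mulrBr; apply/andP; split; lra.
  have [st|/ltW st] := leP s t.
    have [r _ /eqP] := is_derive_mvt st (fun r _ => kE r).
    rewrite subr_eq => /eqP ->; rewrite addrC lerD2l ger0_norm ?subr_ge0//.
    by rewrite ler_wpM2r ?subr_ge0// (le_trans (ler_norm _)).
  have [r _ /eqP] := is_derive_mvt st (fun r _ => kE r).
  rewrite subr_eq => /eqP ->; rewrite distrC ger0_norm ?subr_ge0//.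
  rewrite addrAC -mulrDl addrC lerDl mulr_ge0 ?subr_ge0//.
  by have := dkK r; rewrite ler_norml => /andP[]; lra.
have leS h1 h2 k1 k2 : S h1 k1 -> S h2 k2 -> L h1 -> L h2 ->
    (forall t, h1 t <= h2 t) -> forall t, k1 t <= k2 t.
  move=> [[k1b _] k1E] [[k2b _] k2E] [h1b _] [h2b _] h12.
  apply: (bounded_linear_ode_le M0 k1E k2E _ _ _) => t.
  - exact: normB (k1b t).
  - exact: normB (k2b t).
  - have /andP[? ?] := h1b t; have /andP[? ?] := h2b t.
    by apply: mPhi.
(* Knaster-Tarski: [H] is the largest [h] in [L] below its image. *)
pose A h := L h /\ exists2 k, S h k & forall t, h t <= k t.
have Alo : A (fun=> lo).
  have Llo : L (fun=> lo).
    split=> [t|s t]; first by rewrite lexx.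
    by rewrite lerDl mulr_ge0// mulr_ge0 ?subr_ge0// ltW.
  split=> //; have [k Sk] := exS _ Llo; exists k => // t.
  by have [[kb _] _] := Sk; have /andP[] := kb t.
pose V t := [set h t | h in A].
have Vub t : ubound (V t) hi.
  by move=> _ [h [[hb _] _] <-]; have /andP[] := hb t.
have supV t : has_sup (V t).
  by split; [exists lo, (fun=> lo)|exists hi].
pose H t := sup (V t).
have leH h t : A h -> h t <= H t.
  by move=> Ah; apply: sup_upper_bound => //; exists h.
have Hle t x : (forall h, A h -> h t <= x) -> H t <= x.
  move=> hx; apply: ge_sup; first by have [] := supV t.
  by move=> _ [h Ah <-]; exact: hx.
have LH : L H.
  split=> [t|s t]; first by rewrite (leH _ _ Alo) Hle// => h [[/(_ t)/andP[]]].
  apply: Hle => h Ah; have [[_ hK] _] := Ah.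
  by rewrite (le_trans (hK s t))// lerD2r leH.
have [k Sk] := exS _ LH.
have Hk t : H t <= k t.
  apply: Hle => h Ah; have [Lh [kh Skh hkh]] := Ah.
  apply: le_trans (hkh t) _; apply: (leS _ _ _ _ Skh Sk Lh LH) => s.
  exact: leH.
have Lk : L k by case: Sk.
(* Monotonicity turns [H <= k] into [k <= k2], so [k] itself belongs to [A] and [k <= H]. *)
have [k2 Sk2] := exS _ Lk.
have Ak : A k by split=> //; exists k2 => //; exact: leS Sk Sk2 LH Lk Hk.
have kH : k = H.
  by apply/funext => t; apply/eqP; rewrite eq_le Hk leH.
exists H => t; split; first by case: LH.
by case: Sk => _ /(_ t); rewrite kH.
Qed.

End BoundedSolutions.

(** * The exponent [d] and the first-order equation for [h] *)

Section ReducedEquation.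
Context {R : realType}.
Variables (r lambda eps Q : R).
Hypotheses (r0 : 0 < r) (lambda0 : 0 < lambda) (eps0 : 0 < eps) (Q0 : 0 < Q).

(** The equality is [r d^2 - (r + lambda + Q) d + lambda = 0], of which [d] is the larger root. The
    quadratic is negative at [1] and at [lambda / r], so this root exceeds both. *)
Lemma larger_root_gt s d : s = Num.sqrt ((r + lambda + Q) ^+ 2 - 4 * r * lambda) ->
  d = (2 * r)^-1 * ((r + lambda + Q) + s) ->
  [/\ 1 < d, lambda < r * d & (d - 1) * (r * d - lambda) = Q * d].
Proof.
move=> sE dE; have s0 : 0 <= s by rewrite sE sqrtr_ge0.
have ss : s ^+ 2 = (r + lambda + Q) ^+ 2 - 4 * r * lambda.
  rewrite sE sqr_sqrtr//.
  have -> : (r + lambda + Q) ^+ 2 - 4 * r * lambda =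
    (r - lambda + Q) ^+ 2 + 4 * lambda * Q by ring.
  by rewrite addr_ge0 ?sqr_ge0// !mulr_ge0// ltW.
have rd : r * d = 2^-1 * ((r + lambda + Q) + s) by rewrite dE; field; rewrite gt_eqF.
(* Applied to [s ^+ 2] written as [(lambda + Q - r)^2 + 4 r Q] and as
   [(r - lambda + Q)^2 + 4 lambda Q], this gives the two strict inequalities. *)
have gt_s x y : 0 < y -> s ^+ 2 = x ^+ 2 + y -> - x < s.
  move=> y0 sx; rewrite ltNge; apply/negP => sNx.
  have : s ^+ 2 <= (- x) ^+ 2 by rewrite lerXn2r// nnegrE// (le_trans s0).
  by rewrite sx sqrrN; lra.
have s1 : - (lambda + Q - r) < s.
  apply: (@gt_s _ (4 * r * Q)); first by rewrite !mulr_gt0.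
  by rewrite ss; ring.
have s2 : - (r - lambda + Q) < s.
  apply: (@gt_s _ (4 * lambda * Q)); first by rewrite !mulr_gt0.
  by rewrite ss; ring.
split.
- by rewrite -(ltr_pM2l r0) mulr1 rd; lra.
- by rewrite rd; lra.
apply: (mulfI (lt0r_neq0 r0)).
have -> : r * ((d - 1) * (r * d - lambda)) = (r * d - r) * (r * d - lambda) by ring.
have -> : r * (Q * d) = Q * (r * d) by ring.
rewrite rd.
have -> : (2^-1 * (r + lambda + Q + s) - r) * (2^-1 * (r + lambda + Q + s) - lambda)
  = 4^-1 * (s ^+ 2 + 2 * Q * s + (lambda + Q - r) * (r + Q - lambda)) by field.
by rewrite ss; field.
Qed.

(* [e^t] is truncated at [1] so that the equation can be solved on the whole line;
   only [t <= 0], that is [u <= 1], matters. *)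
Lemma reduced_ode d : 1 < d -> lambda < r * d ->
    (d - 1) * (r * d - lambda) = Q * d ->
  exists h : R -> R, forall t, [/\ lambda < r * h t, h t <= d &
    is_derive t 1 h (1 - h t + Q * h t / (r * h t - lambda)
                     - eps * Num.min (expR t) 1 * h t)].
Proof.
move=> d1 rd dQ.
(* [q] makes [Q lo / (r lo - lambda) = (1 + eps) lo], so [lo] is a subsolution. *)
pose q := Q / (1 + eps); pose lo := (lambda + q) / r.
have e1 : 0 < 1 + eps by rewrite addr_gt0.
have q0 : 0 < q by rewrite divr_gt0.
have rlo : r * lo = lambda + q by rewrite /lo; field; rewrite gt_eqF.
(* With [a] the truncated exponential, the right-hand side has slope [- 1 - eps a - Q lambda / (r x
   - lambda)^2] in [x]. As [a <= 1] and [r x - lambda >= q] for [x >= lo], adding [M * x] makes it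
   nondecreasing. *)
pose M := 1 + eps + Q * lambda / q ^+ 2.
have Mq : 0 < Q * lambda / q ^+ 2 by apply: divr_gt0; [exact: mulr_gt0|exact: exprn_gt0].
have M0 : 0 < M by rewrite /M !addr_gt0.
(* It suffices that [q <= Q <= r d - lambda]. If [r d - lambda < Q], then
   [(d - 1) (r d - lambda) < (d - 1) Q < Q d], against [dQ]. *)
have lod : lo <= d.
  rewrite -(ler_pM2l r0) rlo -lerBrDl.
  apply: (@le_trans _ _ Q).
    by rewrite /q ler_pdivrMr// ler_peMr ?ltW// ltrDl.
  rewrite leNgt; apply/negP => dQ'.
  have : (d - 1) * (r * d - lambda) < (d - 1) * Q by rewrite ltr_pM2l// subr_gt0.
  by rewrite dQ; have := Q0; lra.
pose a t := Num.min (expR t) 1 : R.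
have a0 t : 0 <= a t by rewrite le_min expR_ge0 ler01.
have a1 t : a t <= 1 by rewrite ge_min lexx orbT.
pose Phi t x := M * x + (1 - x + Q * x / (r * x - lambda) - eps * a t * x).
have qx x : lo <= x -> q <= r * x - lambda.
  by rewrite -(ler_pM2l r0) rlo; lra.
have [|t x y lx xy yh|t|t|h hE] := @bounded_ode R Phi M lo d M0 lod.
- move=> h ch hb t; rewrite /continuous_at /Phi.
  have qht : r * h t - lambda != 0.
    have /andP[/qx lh _] := hb t; rewrite gt_eqF//; lra.
  have cM c : {for t, continuous (fun s => c * h s)}.
    by apply: cvgM; [exact: cvg_cst|exact: ch].
  apply: cvgD; first exact: cM.
  apply: cvgB; first apply: cvgD.
  + by apply: cvgB; [exact: cvg_cst|exact: ch].
  + apply: cvgM; first exact: cM.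
    apply: cvgV => //; apply: cvgB; first exact: cM.
    exact: cvg_cst.
  + apply: cvgM; last exact: ch.
    apply: cvgM; first exact: cvg_cst.
    apply: (@continuous_min _ _ expR (fun=> 1)); first exact: continuous_expR.
    exact: cvg_cst.
- have := qx _ lx; have := qx _ (le_trans lx xy) => qy' qx'.
  have qy0 : 0 < r * y - lambda by lra.
  have qx0 : 0 < r * x - lambda by lra.
  rewrite -subr_ge0 /Phi.
  have -> : M * y + (1 - y + Q * y / (r * y - lambda) - eps * a t * y) -
    (M * x + (1 - x + Q * x / (r * x - lambda) - eps * a t * x)) =
    (y - x) * (eps * (1 - a t) +
      (Q * lambda / q ^+ 2 - Q * lambda / ((r * x - lambda) * (r * y - lambda)))).
    rewrite {1 2}/M; field.
    by rewrite !gt_eqF.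
  rewrite mulr_ge0 ?subr_ge0// addr_ge0//.
    by rewrite mulr_ge0 ?subr_ge0// ltW.
  have qq : 0 < q ^+ 2 by exact: exprn_gt0.
  have qxy : 0 < (r * x - lambda) * (r * y - lambda) by exact: mulr_gt0.
  rewrite subr_ge0 ler_pM2l; last by exact: mulr_gt0.
  rewrite lef_pV2 ?posrE//.
  by rewrite expr2 ler_pM// ltW.
(* At [lo] the right-hand side of the equation is [1 + eps (1 - a t) lo >= 0]. *)
- rewrite /Phi lerDl.
  have -> : r * lo - lambda = q by rewrite rlo; ring.
  have -> : Q * lo / q = (1 + eps) * lo.
    by rewrite /q; field; rewrite !gt_eqF.
  have l0 : 0 <= lo by rewrite divr_ge0 ?ltW// addr_gt0.
  have : eps * a t * lo <= eps * 1 * lo by rewrite ler_wpM2r// ler_pM2l.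
  lra.
(* At [d] the fraction equals [d - 1] by [dQ], which leaves [- eps (a t) d <= 0]. *)
- rewrite /Phi gerDl -dQ mulfK ?gt_eqF ?subr_gt0//.
  have : 0 <= eps * a t * d by rewrite !mulr_ge0// ltW// (lt_trans ltr01).
  lra.
exists h => t; have [/andP[/qx h1 h2] hd] := hE t; split=> //; first by lra.
by apply: (is_derive_eq hd); rewrite /Phi addrAC subrr add0r.
Qed.

End ReducedEquation.

(** * Autonomous equations by separation of variables *)

Section Trajectory.
Context {R : realType}.
Implicit Types (t x : R).

(** The travel time [X], the primitive of [1 / h] vanishing at [0], has slope at least [1 / hi > 0].
    Hence it is a bijection of the line, and [y] is its inverse. *)
Lemma autonomous_ode (h : R -> R) lo hi : continuous h -> 0 < lo ->
    (forall t, lo <= h t <= hi) ->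
  exists y : R -> R, y 0 = 0 /\ forall x, is_derive x 1 y (h (y x)).
Proof.
move=> ch lo0 hb; have h0 t : 0 < h t.
  by have /andP[ht _] := hb t; exact: lt_le_trans lo0 ht.
have hi0 : 0 < hi by have /andP[_] := hb 0; exact: lt_le_trans (h0 0).
have [|X [X0 XE]] := @primitive _ (fun t => (h t)^-1).
  by move=> t; apply: cvgV; [rewrite gt_eqF|exact: ch].
have cX : continuous X by move=> t; exact: is_derive_cont (XE t).
have X_lt : {homo X : s t / s < t}.
  move=> s t st; have [c _ XstE] := is_derive_mvt (ltW st) (fun r _ => XE r).
  by rewrite -subr_gt0 XstE mulr_gt0 ?invr_gt0 ?subr_gt0.
have X_inj : injective X.
  by apply: inc_inj; apply: le_mono.
have X_ge s t : s <= t -> (t - s) / hi <= X t - X s.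
  move=> st; have [c _ ->] := is_derive_mvt st (fun r _ => XE r).
  rewrite mulrC ler_wpM2r ?subr_ge0// lef_pV2 ?posrE//.
  by have /andP[] := hb c.
have X_surj x : exists t, X t = x.
  have x0 : 0 <= `|x| * hi by rewrite mulr_ge0// ltW.
  have x0N : - (`|x| * hi) <= 0 by rewrite oppr_le0.
  have := X_ge _ _ x0; have := X_ge _ _ x0N.
  rewrite X0 sub0r opprK !subr0 sub0r mulfK ?gt_eqF// => xN xP.
  have [||t _ tx] := @IVT R X _ _ x (le_trans x0N x0); last by exists t.
    exact: continuous_subspaceT.
  have := ler_norm x; have := ler_norm (- x); rewrite normrN => x1 x2.
  by rewrite ge_min le_max; apply/andP; split; apply/orP; [left|right]; lra.
have [y yE] := choice X_surj.
have yK : cancel X y by move=> t; apply: X_inj; rewrite yE.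
exists y; split; first by rewrite -X0 yK.
move=> x; rewrite -{1}(yE x) -[h _]invrK.
apply: is_derive_inverse.
- by near=> z; exact: yK.
- by near=> z; exact: cX.
- by rewrite invr_eq0 gt_eqF.
Unshelve. all: by end_near. Qed.

End Trajectory.

(** * The classical solution and its two bounds *)

Section ClassicalSolution.
Context {R : realType}.
Variables (r lambda eps Q c b d : R).
Hypotheses (r0 : 0 < r) (lambda0 : 0 < lambda) (eps0 : 0 < eps) (Q0 : 0 < Q).
Hypotheses (d1 : 1 < d) (rd : lambda < r * d) (dQ : (d - 1) * (r * d - lambda) = Q * d).
Hypothesis rb : r * b < c.

(** The exponent in [pfrak]. *)
Let m := Q / r + 1.

(* In terms of [g = u h], this says [g >= m (1 - e^{-eps u}) / eps], the right-hand
   side being the slope [- u_x] along [pfrak]. *)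
Lemma reduced_ode_ge (h : R -> R) :
    (forall t, [/\ lambda < r * h t, h t <= d &
    is_derive t 1 h (1 - h t + Q * h t / (r * h t - lambda)
                     - eps * Num.min (expR t) 1 * h t)]) ->
  forall t, t <= 0 ->
  m * (expR (eps * expR t) - 1) <= expR (eps * expR t) * (eps * expR t) * h t.
Proof.
move=> hE t t0.
pose z s := eps * expR s.
have z0 s : 0 < z s by rewrite mulr_gt0 ?expR_gt0.
have zE (s : R) : is_derive s 1 z (z s).
  exact: is_derive_cmulf (is_derive_expR s).
have h0 s : 0 < h s.
  have [h1 _ _] := hE s; rewrite -(pmulr_rgt0 _ r0); exact: lt_trans h1.
have m0 : 0 < m by rewrite /m addr_gt0// divr_gt0.
(* [k t >= 0] is the claim divided by [z t]. *)
pose k s := h s * expR (z s) - m * ((expR (z s) - 1) * (z s)^-1).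
suff : 0 <= k t.
  rewrite /k subr_ge0 mulrA ler_pdivrMr// => H.
  have -> // : expR (eps * expR t) * (eps * expR t) * h t = h t * expR (z t) * z t.
  by rewrite /z; ring.
(* This is [k'] for [s <= 0]: the term [- eps e^s h] of the equation cancels the one from
   differentiating [expR (z s)]. Then [k' + k >= 0] because [h / (r h - lambda) >= 1 / r]. *)
pose dk s := expR (z s) * (1 + Q * h s / (r * h s - lambda) - m) - k s.
apply: (@bounded_below_ge0 _ k dk 1 (- (m * expR eps)) 0) => //.
- move=> s s0; have [h1 _ hsE] := hE s.
  have es1 : expR s <= 1 by rewrite expR_le1.
  have rh : r * h s - lambda != 0 by rewrite gt_eqF// subr_gt0.
  have ez := is_derive_expf (zE s).
  have := is_derive_subf (is_derive_mulf hsE ez) (is_derive_cmulf m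
    (is_derive_mulf (is_derive_subf ez (is_derive_cstf s 1))
      (is_derive_invf (lt0r_neq0 (z0 s)) (zE s)))).
  move=> /is_derive_eq; apply; rewrite min_l// -/(z s) /dk /k.
  by field; rewrite rh gt_eqF.
- move=> s _; rewrite mul1r /dk subrK mulr_ge0 ?expR_ge0//.
  have [h1 _ _] := hE s.
  rewrite /m (addrC (Q / r)) opprD addrACA subrr add0r subr_ge0.
  rewrite -mulrA ler_pM2l// ler_pdivlMr ?subr_gt0//.
  by rewrite ler_pdivrMl// lerBlDr lerDl ltW.
(* The lower bound on [k] comes from [(e^z - 1) / z <= e^z <= e^eps]. *)
- move=> s s0.
  have z1 : z s <= eps by rewrite /z ler_piMr ?expR_le1// ltW.
  have : (expR (z s) - 1) * (z s)^-1 <= expR eps.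
    rewrite ler_pdivrMr//.
    apply: (@le_trans _ _ (expR (z s) * z s)).
      have := expR_ge1Dx (- z s).
      rewrite -(ler_pM2l (expR_gt0 (z s))) -expRD subrr expR0; lra.
    by rewrite ler_pM2r// ler_expR.
  rewrite -(ler_pM2l m0) /k => H.
  have : 0 <= h s * expR (z s) by rewrite mulr_ge0 ?expR_ge0// ltW.
  lra.
Qed.

(** The second clause is [F = 0] with the infimum evaluated, which [eps p^2 + A > 0] permits, and
    the denominator cleared. Differentiability extends to the left of [b], so that [u] is continuous
    at [b]. The upper bound is [u <= pfrak] in exponential form. *)
Lemma classical_solution : exists u p A : R -> R,
  [/\ forall w, r * w < c -> is_derive w 1 u (p w) /\ is_derive w 1 p (A w),
      forall w, b < w -> r * w < c ->
        0 < eps * p w ^+ 2 + A w /\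
        (lambda * u w + (c - r * w) * p w) * (eps * p w ^+ 2 + A w)
        = - (Q * p w ^+ 2),
      u b = 1, forall w, c <= r * w -> u w = 0 &
      forall w, b <= w -> r * w < c ->
        ((c - r * w) / (c - r * b)) `^ d <= u w /\
        expR (eps * u w) <= 1 + (expR eps - 1) * ((c - r * w) / (c - r * b)) `^ m].
Proof.
have [h hE] := reduced_ode r0 lambda0 eps0 Q0 d1 rd dQ.
have h0 t : 0 < h t.
  by have [h1 _ _] := hE t; rewrite -(pmulr_rgt0 _ r0); exact: lt_trans h1.
have [||t|y [y0 yE]] := @autonomous_ode R (fun t => h (- t)) (lambda / r) d.
- move=> t; apply: continuous_comp; first exact: opp_continuous.
  by have [_ _] := hE (- t); exact: is_derive_cont.
- exact: divr_gt0.
- by have [h1 -> _] := hE (- t); rewrite andbT ler_pdivrMr// mulrC ltW.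
(* [th] is [ln u] as a function of [x = - ln S]; the sign change turns [y' = h (- y)] into
   [th' = - h th]. *)
pose th x := - y x.
have thE (x : R) : is_derive x 1 th (- h (th x)) by exact: is_derive_oppf (yE x).
have th0 : th 0 = 0 by rewrite /th y0 oppr0.
have th_ge (x : R) : 0 <= x -> - (d * x) <= th x.
  move=> x0; have [s _] := is_derive_mvt x0 (fun s _ => thE s).
  rewrite th0 !subr0 => ->; rewrite mulNr lerN2 ler_wpM2r//.
  by have [] := hE (th s).
have th_le (x : R) : 0 <= x -> th x <= 0.
  move=> x0; have [s _] := is_derive_mvt x0 (fun s _ => thE s).
  by rewrite th0 !subr0 => ->; rewrite mulNr oppr_le0 mulr_ge0// ltW.
have th_lt (x : R) : 0 < x -> th x < 0.
  move=> x0; have [s _] := is_derive_mvt (ltW x0) (fun s _ => thE s).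
  by rewrite th0 !subr0 => ->; rewrite mulNr oppr_lt0 mulr_gt0.
have th_exp (x : R) : 0 <= x ->
    expR (eps * expR (th x)) - 1 <= (expR eps - 1) * expR (- (m * x)).
  move=> x0; pose z s := eps * expR (th s).
  have zE (s : R) : is_derive s 1 z (- (z s * h (th s))).
    apply: (is_derive_eq (is_derive_cmulf eps (is_derive_expf (thE s)))).
    by rewrite /z; ring.
  have EE (s : R) := is_derive_oppf (is_derive_mulf
    (is_derive_subf (is_derive_expf (zE s)) (is_derive_cstf s 1))
    (is_derive_expf (is_derive_cmulf m (is_derive_idf s)))).
  (* By [reduced_ode_ge] at [th s], the product [(e^z - 1) e^{m s}] is nonincreasing in [s]; hence
     the minus signs. *)
  suff : - ((expR (z 0) - 1) * expR (m * 0)) <= - ((expR (z x) - 1) * expR (m * x)).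
    have -> : z 0 = eps by rewrite /z th0 expR0 mulr1.
    by rewrite mulr0 expR0 mulr1 lerN2 expRN ler_pdivlMr ?expR_gt0.
  apply: (is_derive_ge0_le x0 (fun s _ => EE s)) => s /andP[s0 _].
  have := reduced_ode_ge hE (th_le _ s0); rewrite -/(z s) => H.
  have -> : - ((expR (z s) * - (z s * h (th s)) - 0) * expR (m * s) +
     (expR (z s) - 1) * (expR (m * s) * (m * 1))) = expR (m * s) *
     (expR (z s) * z s * h (th s) - m * (expR (z s) - 1)) by ring.
  by rewrite mulr_ge0 ?expR_ge0// subr_ge0.
have k0 : 0 < c - r * b by rewrite subr_gt0.
pose S w := (c - r * w) / (c - r * b).
have S0 (w : R) : r * w < c -> 0 < S w by move=> wc; rewrite divr_gt0// subr_gt0.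
pose T w := th (- ln (S w)).
pose u w := if r * w < c then expR (T w) else 0.
pose g w := r / (c - r * w).
pose p w := - (u w * h (T w) * g w).
pose dh t := 1 - h t + Q * h t / (r * h t - lambda)
                     - eps * Num.min (expR t) 1 * h t.
pose A w := u w * h (T w) * g w ^+ 2 * (h (T w) + dh (T w) - 1).
have SE (w : R) : is_derive w 1 S (- r / (c - r * b)).
  have := is_derive_mulf (is_derive_subf (is_derive_cstf w c)
    (is_derive_cmulf r (is_derive_idf w))) (is_derive_cstf w (c - r * b)^-1).
  by move=> /is_derive_eq; apply; ring.
have TE (w : R) : r * w < c -> is_derive w 1 T (- (h (T w) * g w)).
  move=> wc; have Sw := S0 _ wc.
  have := is_derive_compf (is_derive_oppf (is_derive_compf (SE w)
    (is_derive1_ln Sw))) (thE (- ln (S w))).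
  move=> /is_derive_eq; apply; rewrite -/(T w) /S /g.
  by field; rewrite !gt_eqF ?subr_gt0.
have near_lt (w : R) : r * w < c -> \forall z \near w, r * z < c.
  move=> wc; near=> z; rewrite mulrC -ltr_pdivlMr//; near: z.
  by apply: lt_nbhsl; rewrite ltr_pdivlMr// mulrC.
have uE (w : R) : r * w < c -> is_derive w 1 u (p w).
  move=> wc; apply: (@is_derive_near _ (fun z => expR (T z))).
    by near=> z; rewrite /u ifT//; near: z; exact: near_lt.
  apply: (is_derive_eq (is_derive_expf (TE _ wc))).
  by rewrite /p /u wc; ring.
have gE (w : R) : r * w < c -> is_derive w 1 g (g w ^+ 2).
  move=> wc; have cw : c - r * w != 0 by rewrite gt_eqF ?subr_gt0.
  have := is_derive_cmulf r (@is_derive_invf _ (fun w => c - r * w) _ _ cw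
    (is_derive_subf (is_derive_cstf w c) (is_derive_cmulf r (is_derive_idf w)))).
  by move=> /is_derive_eq; apply; rewrite /g; field.
have pE (w : R) : r * w < c -> is_derive w 1 p (A w).
  move=> wc; have hT : is_derive (T w) 1 h (dh (T w)) by have [] := hE (T w).
  have := is_derive_oppf (is_derive_mulf (is_derive_mulf (uE _ wc)
    (is_derive_compf (TE _ wc) hT)) (gE _ wc)).
  by move=> /is_derive_eq; apply; rewrite /A /p; ring.
have lnS (w : R) : b <= w -> r * w < c -> 0 <= - ln (S w).
  move=> bw wc; rewrite oppr_ge0 ln_le0// ler_pdivrMr// mul1r.
  by rewrite lerD2l lerN2 ler_pM2l.
have Sb : S b = 1 by rewrite /S divff// gt_eqF.
exists u, p, A; split.
- by move=> w wc; split; [exact: uE|exact: pE].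
- move=> w bw wc.
  have Tw : T w < 0.
    apply: th_lt; rewrite oppr_gt0 ln_lt0// S0//=.
    by rewrite ltr_pdivrMr// mul1r ltrD2l ltrN2 ltr_pM2l.
  have [rh _ _] := hE (T w).
  have rh0 : 0 < r * h (T w) - lambda by rewrite subr_gt0.
  have u0 : 0 < u w by rewrite /u wc expR_gt0.
  have cw : 0 < c - r * w by rewrite subr_gt0.
  have g0 : 0 < g w by rewrite divr_gt0.
  (* When [h'] is replaced using the reduced equation, the terms [1 - h] and [eps u h] cancel and
     only the [Q] term remains. The truncation is inactive since [T w < 0]. *)
  have BE : eps * p w ^+ 2 + A w =
      u w * g w ^+ 2 * h (T w) ^+ 2 * (Q / (r * h (T w) - lambda)).
    have uT : Num.min (expR (T w)) 1 = u w.
      by rewrite /u wc min_l// expR_le1 ltW.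
    by rewrite /A /dh uT /p; field; rewrite gt_eqF.
  rewrite BE; split.
    apply: mulr_gt0; last exact: divr_gt0.
    by apply: mulr_gt0; [apply: mulr_gt0|]; rewrite ?exprn_gt0.
  (* As [(c - r w) g = r], the first factor is [- u (r h - lambda)], which cancels the denominator
     in [BE]. *)
  by rewrite /p /g; field; rewrite !gt_eqF.
- by rewrite /u rb /T Sb ln1 oppr0 th0 expR0.
- by move=> w cw; rewrite /u ltNge cw.
move=> w bw wc; have x0 := lnS _ bw wc; have Sw := S0 _ wc.
have powS e : S w `^ e = expR (- (e * - ln (S w))).
  by rewrite /powR gt_eqF// mulrN opprK.
rewrite -/(S w) !powS /u wc; split.
  by rewrite ler_expR; exact: th_ge.
by rewrite -lerBlDl; exact: th_exp.
Unshelve. all: by end_near. Qed.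

End ClassicalSolution.

(** * Semicontinuous envelopes at points of continuity *)

Section Envelopes.
Context {R : realType}.
Implicit Types (D : set R) (u : R -> R) (x : R).

Lemma within_open D x : open D -> D x -> within D (nbhs x) = nbhs x.
Proof. by move=> oD Dx; apply: within_interior; exact: open_nbhs_nbhs. Qed.

Lemma usc_env_cont D u x : open D -> D x -> {for x, continuous u} ->
  usc_env D u x = (u x)%:E.
Proof.
move=> oD Dx cu; rewrite /usc_env within_open//.
apply/eqP; rewrite eq_le; apply/andP; split.
  apply/lee_addgt0Pr => e e0; rewrite -EFinD.
  apply: ge_ereal_inf => /=.
  exists (ereal_sup ((EFin \o u) @` [set z | u z < u x + e])).
    exists [set z | u z < u x + e] => //.
    by apply: (cvgr_lt _ cu); rewrite ltrDl.
  apply: ge_ereal_sup => _ [z /= zx <-].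
  by rewrite lee_fin ltW.
apply: le_ereal_inf_tmp => _ [A Ax <-].
apply: le_ereal_sup_tmp; exists (u x)%:E => //; exists x => //.
exact: nbhs_singleton.
Qed.

Lemma lsc_env_cont D u x : open D -> D x -> {for x, continuous u} ->
  lsc_env D u x = (u x)%:E.
Proof.
move=> oD Dx cu; rewrite /lsc_env /limf_einf.
have -> : (\- (EFin \o u))%E = EFin \o (\- u) by apply/funext => z.
rewrite -/(usc_env D (\- u) x) usc_env_cont ?EFinN ?oppeK//.
exact: cvgN.
Qed.

End Envelopes.

(** * First- and second-order conditions at contact points with test functions *)

Section SecondOrderTest.
Context {R : realType}.
Implicit Types (f df u p phi : R -> R) (D : set R) (x l : R).

(** If [l > 0], the Caratheodory factor [g] of [df] at [x] is positive near [x]. Then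
    [df z = g z * (z - x) > 0] just to the right of [x], and [f] increases there, against the
    maximum. *)
Lemma local_max_second_order f df x l :
  (\forall z \near x, is_derive (z : R) 1 f (df z)) -> is_derive x 1 df l ->
  (\forall z \near x, f z <= f x) -> df x = 0 /\ l <= 0.
Proof.
move=> fdf dfl fmax.
have [e /= e0 He] : exists2 e : R, 0 < e & forall z : R, `|x - z| < e ->
    is_derive z 1 f (df z) /\ f z <= f x.
  have : \forall z \near x, is_derive (z : R) 1 f (df z) /\ f z <= f x.
    by near=> z; split; near: z.
  by move=> [e /= e0 H]; exists e => // z zx; exact: H.
have dfx : df x = 0.
  have xe : x - e <= x + e by lra.
  have xI : x \in `]x - e, x + e[%R by rewrite in_itv/=; apply/andP; split; lra.
  have [||_ <-] := @derive1_at_max R f _ _ x xe _ xI.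
  - move=> t /[!in_itv]/= /andP[t1 t2].
    have [|[] //] := He t; by rewrite ltr_norml; apply/andP; split; lra.
  - move=> t /[!in_itv]/= /andP[t1 t2].
    have [|//] := He t; by rewrite ltr_norml; apply/andP; split; lra.
  by have [|[_ <-] //] := He x; rewrite subrr normr0.
split=> //; rewrite leNgt; apply/negP => l0.
have /is_derive1_caratheodory [g [gE cg gx]] := dfl.
have : \forall z \near x, 0 < g z by apply: (cvgr_gt _ cg); rewrite gx.
move=> [e' /= e'0 He'].
pose s := Num.min e e' / 2.
have s0 : 0 < s by rewrite divr_gt0// lt_min e0.
have se : s < e.
  have : Num.min e e' <= e by rewrite ge_min lexx.
  by rewrite /s; lra.
have se' : s < e'.
  have : Num.min e e' <= e' by rewrite ge_min lexx orbT.
  by rewrite /s; lra.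
have near_x z : x <= z <= x + s -> `|x - z| <= s.
  by move=> /andP[? ?]; rewrite ler_norml; apply/andP; split; lra.
have xxs : x < x + s by rewrite ltrDl.
have [z||z] := @MVT R f df x (x + s) xxs.
- move=> /[!in_itv]/= /andP[z1 z2]; have [|//] := He z.
  by apply: le_lt_trans (near_x z _) se; rewrite !ltW.
- apply: continuous_in_subspaceT => z /[!inE]/= /[!in_itv]/= zI.
  have [|zd _] := He z; last exact: is_derive_cont zd.
  exact: le_lt_trans (near_x z _) se.
move=> /[!in_itv]/= /andP[z1 z2] fE.
have [|_ fle] := He (x + s).
  by apply: le_lt_trans (near_x _ _) se; rewrite lexx ltW.
suff : f x < f (x + s) by rewrite ltNge fle.
rewrite -subr_gt0 fE mulr_gt0 ?subr_gt0//.
have -> : df z = g z * (z - x) by rewrite -gE dfx subr0.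
rewrite mulr_gt0 ?subr_gt0//; apply: He' => /=.
by apply: le_lt_trans (near_x _ _) se'; rewrite !ltW.
Unshelve. all: by end_near. Qed.

Lemma C2_on_is_derive D phi x : C2_on D phi -> D x ->
  is_derive x 1 phi (derive1 phi x) /\
  is_derive x 1 (derive1 phi) (derive1n 2 phi x).
Proof.
move=> Cphi Dx; have [phi1 phi2 _] := Cphi _ Dx.
split; first by rewrite derive1E; exact: derivableP.
by rewrite derive1nS derive1n1 derive1E; exact: derivableP.
Qed.

Lemma local_max_test D u p l phi x : open D -> D x ->
  (forall z, D z -> is_derive z 1 u (p z)) -> is_derive x 1 p l ->
  C2_on D phi -> local_max_on D (fun w => u w - phi w) x ->
  derive1 phi x = p x /\ l <= derive1n 2 phi x.
Proof.
move=> oD Dx up pl Cphi; rewrite /local_max_on within_open//.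
move=> umax.
have [||] := @local_max_second_order (fun w => u w - phi w)
  (fun w => p w - derive1 phi w) x (l - derive1n 2 phi x) _ _ umax.
- near=> z; have Dz : D z by near: z; exact: open_nbhs_nbhs.
  exact: (is_derive_subf (up _ Dz) (C2_on_is_derive Cphi Dz).1).
- exact: (is_derive_subf pl (C2_on_is_derive Cphi Dx).2).
by move=> /eqP; rewrite subr_eq0 => /eqP -> ; rewrite subr_le0.
Unshelve. all: by end_near. Qed.

Lemma local_min_test D u p l phi x : open D -> D x ->
  (forall z, D z -> is_derive z 1 u (p z)) -> is_derive x 1 p l ->
  C2_on D phi -> local_min_on D (fun w => u w - phi w) x ->
  derive1 phi x = p x /\ derive1n 2 phi x <= l.
Proof.
move=> oD Dx up pl Cphi; rewrite /local_min_on within_open//.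
move=> umin.
have [|||] := @local_max_second_order (fun w => phi w - u w)
  (fun w => derive1 phi w - p w) x (derive1n 2 phi x - l).
- near=> z; have Dz : D z by near: z; exact: open_nbhs_nbhs.
  exact: (is_derive_subf (C2_on_is_derive Cphi Dz).1 (up _ Dz)).
- exact: (is_derive_subf (C2_on_is_derive Cphi Dx).2 pl).
- by apply: filterS umin => z; lra.
by move=> /eqP; rewrite subr_eq0 => /eqP -> ; rewrite subr_le0.
Unshelve. all: by end_near. Qed.

End SecondOrderTest.

(** * Classical solutions are viscosity solutions *)

Section ClassicalIsViscosity.
Context {R : realType}.
Implicit Types (D : set R) (u p A : R -> R).

(** At a contact point the test function has slope [p x], but its second derivative is only known to
    lie above [A x] (maximum) or below it (minimum). Requiring the inequalities for all such [l]
    builds in degenerate ellipticity. *)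
Lemma classical_viscosity (F : R -> R -> R -> R -> \bar R) D u p A :
  open D -> (forall x, D x -> is_derive x 1 u (p x) /\ is_derive x 1 p (A x)) ->
  (forall x l, D x -> A x <= l -> (F x (u x) (p x) l <= 0)%E) ->
  (forall x l, D x -> l <= A x -> (0 <= F x (u x) (p x) l)%E) ->
  viscosity_solution F D u.
Proof.
move=> oD upA Fsub Fsup.
have cu x : D x -> {for x, continuous u}.
  by move=> /upA[ux _]; exact: is_derive_cont ux.
have uE x : D x -> usc_env D u x = (u x)%:E.
  by move=> Dx; exact: usc_env_cont (cu _ Dx).
have lE x : D x -> lsc_env D u x = (u x)%:E.
  by move=> Dx; exact: lsc_env_cont (cu _ Dx).
have up z : D z -> is_derive z 1 u (p z) by move=> /upA[].
split; first by move=> x Dx; rewrite uE// lE.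
- split=> [x Dx y|phi x Cphi Dx].
    rewrite uE//= => uxy; rewrite within_open//.
    near=> z; rewrite uE/=; last by near: z; exact: open_nbhs_nbhs.
    by near: z; exact: (cvgr_lt _ (cu _ Dx)).
  move=> umax; rewrite uE//=.
  have [||-> H] := @local_max_test _ D u p (A x) phi x oD Dx up _ Cphi.
  + by have [] := upA _ Dx.
  + move: umax; rewrite /local_max_on within_open//; apply: filter_app.
    near=> z; rewrite !uE//; near: z; exact: open_nbhs_nbhs.
  + exact: Fsub.
- split=> [x Dx y|phi x Cphi Dx].
    rewrite lE//= => uxy; rewrite within_open//.
    near=> z; rewrite lE/=; last by near: z; exact: open_nbhs_nbhs.
    by near: z; exact: (cvgr_gt _ (cu _ Dx)).
  move=> umin; rewrite lE//=.
  have [||-> H] := @local_min_test _ D u p (A x) phi x oD Dx up _ Cphi.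
  + by have [] := upA _ Dx.
  + move: umin; rewrite /local_min_on within_open//; apply: filter_app.
    near=> z; rewrite !lE//; near: z; exact: open_nbhs_nbhs.
  + exact: Fsup.
Unshelve. all: by end_near. Qed.

End ClassicalIsViscosity.

(** * Evaluation of the infimum over the controls *)

Section Hamiltonian.
Context {R : realType}.
Variables (r mu sigma c lambda eps : R) (w u p A : R).
Hypothesis sigma0 : 0 < sigma.
Hypothesis B0 : 0 < eps * p ^+ 2 + A.
Hypothesis eqn : (lambda * u + (c - r * w) * p) * (eps * p ^+ 2 + A)
  = - (Rconst r mu sigma * p ^+ 2).

(** Every control must give at least [lambda u]. Raising [A] to [l] adds a nonnegative term; after
    multiplication by [eps p^2 + A], the rest is half a square by [eqn]. *)
Lemma hjbF_le0 l : A <= l -> (hjbF r mu sigma c lambda eps w u p l <= 0)%E.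
Proof.
move=> Al; rewrite /hjbF sube_le0.
apply: le_ereal_inf_tmp => _ [x _ <-]; rewrite lee_fin.
move: B0 eqn; set B := eps * p ^+ 2 + A => BB Beqn.
rewrite -subr_ge0 -(pmulr_lge0 _ BB).
have -> : (2^-1 * sigma ^+ 2 * (eps * p ^+ 2 + l) * x ^+ 2 + (mu - r) * p * x +
   (r * w - c) * p - lambda * u) * B =
   2^-1 * sigma ^+ 2 * (l - A) * x ^+ 2 * B + 2^-1 * sigma ^+ 2 * B * x ^+ 2 * B
   + (mu - r) * p * x * B - (lambda * u + (c - r * w) * p) * B.
  by rewrite /B; ring.
rewrite Beqn /Rconst -addrA -addrA addr_ge0//.
  rewrite mulr_ge0 ?(ltW BB)// mulr_ge0 ?sqr_ge0// mulr_ge0 ?subr_ge0//.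
  by rewrite mulr_ge0 ?sqr_ge0.
have -> : 2^-1 * sigma ^+ 2 * B * x ^+ 2 * B + ((mu - r) * p * x * B -
    - (2^-1 * ((mu - r) / sigma) ^+ 2 * p ^+ 2)) =
   2^-1 * (sigma * B * x + (mu - r) * p / sigma) ^+ 2.
  by field; rewrite gt_eqF.
by rewrite mulr_ge0 ?sqr_ge0.
Qed.

(** One control giving at most [lambda u] suffices, even if the infimum is [-oo]. *)
Lemma hjbF_ge0 l : l <= A -> (0 <= hjbF r mu sigma c lambda eps w u p l)%E.
Proof.
move=> lA; rewrite /hjbF subre_ge0//.
move: B0 eqn; set B := eps * p ^+ 2 + A => BB Beqn.
(* The minimizer for the coefficient [A], with value exactly [lambda u]; lowering [A] to [l] can
   only lower the value at [x]. *)
pose x := - ((mu - r) * p) / (sigma ^+ 2 * B).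
apply: ge_ereal_inf; eexists; first by exists x.
rewrite lee_fin -subr_ge0 -(pmulr_lge0 _ BB).
have -> : (lambda * u - (2^-1 * sigma ^+ 2 * (eps * p ^+ 2 + l) * x ^+ 2
   + (mu - r) * p * x + (r * w - c) * p)) * B =
   2^-1 * sigma ^+ 2 * (A - l) * x ^+ 2 * B + (- (2^-1 * sigma ^+ 2 * B * x ^+ 2 * B)
   - (mu - r) * p * x * B + (lambda * u + (c - r * w) * p) * B).
  by rewrite /B; ring.
rewrite Beqn /Rconst addr_ge0//.
  rewrite mulr_ge0 ?(ltW BB)// mulr_ge0 ?sqr_ge0// mulr_ge0 ?subr_ge0//.
  by rewrite mulr_ge0 ?sqr_ge0.
rewrite le_eqVlt; apply/orP; left; apply/eqP.
by rewrite /x; field; rewrite !gt_eqF.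
Qed.

End Hamiltonian.

(** * The Dirichlet problem *)

Unset Implicit Arguments.
Set Strict Implicit.

Theorem proposition4p2 (R : realType) (r mu sigma c lambda eps b : R)
    (r_gt0 : 0 < r) (mu_gtr : r < mu) (sigma_gt0 : 0 < sigma) (c_gt0 : 0 < c)
    (lambda_gt0 : 0 < lambda) (eps_gt0 : 0 < eps) (b_lt : b < safe_level r c) :
  exists u : R -> R,
    [/\ {within `[b, safe_level r c], continuous u},
        viscosity_solution (hjbF r mu sigma c lambda eps)
          `]b, safe_level r c[ u,
        u b = 1,
        u (safe_level r c) = 0
      & forall w : R, b <= w <= safe_level r c ->
          0 <= u w <= 1 /\
          psi0 r mu sigma c lambda b w <= u w <= pfrak r mu sigma c eps b w].
Proof.
set ws := safe_level r c in b_lt *.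
have rws : r * ws = c by rewrite /ws /safe_level mulrC divfK ?gt_eqF.
have ltws w : (w < ws) = (r * w < c) by rewrite -rws ltr_pM2l.
have Q_gt0 : 0 < Rconst r mu sigma.
  by rewrite mulr_gt0 ?invr_gt0// exprn_gt0// divr_gt0// subr_gt0.
have [d1 rd dQ] := larger_root_gt r_gt0 lambda_gt0 Q_gt0 erefl erefl.
rewrite -/(dconst r mu sigma lambda) in d1 rd dQ.
have rb : r * b < c by rewrite -ltws.
have [u [p [A [upA eqn ub uws ubnd]]]] :=
  classical_solution r_gt0 lambda_gt0 eps_gt0 Q_gt0 d1 rd dQ rb.
have cb_gt0 : 0 < c - r * b by rewrite subr_gt0.
have m1 : 1 <= Rconst r mu sigma / r + 1 by rewrite lerDr divr_ge0 ?ltW.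
have S_le w : b <= w -> r * w < c -> 0 < (c - r * w) / (c - r * b) <= 1.
  move=> bw wc; rewrite divr_gt0 ?subr_gt0//= ler_pdivrMr// mul1r.
  by rewrite lerD2l lerN2 ler_pM2l.
have e1 : 0 < expR eps - 1 by rewrite subr_gt0 expR_gt1.
have u_ge0 w : b <= w -> 0 <= u w.
  move=> bw; have [wc|wc] := ltP (r * w) c; last by rewrite uws.
  by have [+ _] := ubnd _ bw wc; apply: le_trans; exact: powR_ge0.
(* The base lies in [(0, 1]], so the exponent can be lowered to [1]. The resulting bound, affine in
   [w], gives both [u <= 1] and continuity at [ws]. *)
have u_le w : b <= w -> r * w < c ->
    expR (eps * u w) <= 1 + (expR eps - 1) * ((c - r * w) / (c - r * b)).
  move=> bw wc; have [_ H] := ubnd _ bw wc; apply: le_trans H _.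
  rewrite lerD2l ler_pM2l//; apply: ge1r_powR => //; exact: S_le.
have cu w : w < ws -> {for w, continuous u}.
  by rewrite ltws => /upA[]; move=> /is_derive_cont.
exists u; split => //; last 2 first.
- by rewrite uws// rws.
- move=> w /andP[bw]; rewrite le_eqVlt ltws => /predU1P[->|wc].
    have uws0 : u ws = 0 by rewrite uws// rws.
    (* At [ws] the base is [0], and both bounds vanish because the exponents are nonzero. *)
    rewrite uws0 /psi0 /pfrak rws subrr mul0r powR0; last first.
      by rewrite gt_eqF// (lt_trans ltr01).
    rewrite powR0; last by rewrite gt_eqF// (lt_le_trans ltr01).
    by rewrite mulr0 addr0 ln1 mulr0 lexx ler01.
  have [psi_u u_p] := ubnd _ bw wc.
  split; rewrite ?u_ge0//=.
    rewrite -(ler_pM2l eps_gt0) mulr1 -ler_expR.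
    apply: le_trans (u_le _ bw wc) _.
    have /andP[_ S1] := S_le _ bw wc.
    by rewrite -lerBrDl ler_piMr// ltW.
  rewrite psi_u /= /pfrak ler_pdivlMl// -ler_expR lnK//.
  by rewrite posrE ltr_pwDl// mulr_ge0 ?powR_ge0// ltW.
- apply: continuous_in_subspaceT => w /[!inE]/= /[!in_itv]/= /andP[bw].
  rewrite le_eqVlt => /predU1P[->|]; last exact: cu.
  (* Combining [eps u <= e^{eps u} - 1] with [u_le] and [c - r z = r (ws - z)] gives
     [u z <= K (ws - z)]. *)
  pose K := (expR eps - 1) / eps * (r / (c - r * b)).
  have K0 : 0 < K by rewrite mulr_gt0// divr_gt0.
  rewrite /continuous_at uws ?rws//; apply/cvgr0Pnorm_lt => e e0.
  near=> z.
  have bz : b < z by near: z; exact: lt_nbhsr.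
  rewrite ger0_norm ?u_ge0 ?ltW//.
  have [zc|zc] := ltP (r * z) c; last by rewrite uws.
  have zK : u z <= K * (ws - z).
    rewrite -(ler_pM2l eps_gt0).
    have -> : eps * (K * (ws - z)) = (expR eps - 1) * ((c - r * z) / (c - r * b)).
      by rewrite /K -rws; field; rewrite rws !gt_eqF.
    rewrite -(lerD2l 1); apply: le_trans (expR_ge1Dx _) _.
    exact: u_le (ltW bz) zc.
  apply: le_lt_trans zK _; rewrite -ltr_pdivlMl//.
  rewrite ltrBlDr -ltrBlDl; near: z; apply: lt_nbhsr.
  by rewrite gtrBl mulr_gt0 ?invr_gt0.
- apply: (@classical_viscosity _ _ _ u p A).
  + exact: interval_open.
  + by move=> w /=; rewrite in_itv/= ltws => /andP[_ /upA].
  + move=> w l /=; rewrite in_itv/= ltws => /andP[bw wc] Al.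
    by have [B0 E] := eqn _ bw wc; exact: (hjbF_le0 sigma_gt0 B0 E Al).
  + move=> w l /=; rewrite in_itv/= ltws => /andP[bw wc] Al.
    by have [B0 E] := eqn _ bw wc; exact: (hjbF_ge0 sigma_gt0 B0 E Al).
Unshelve. all: by end_near. Qed.
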